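(* Let $J\subseteq\mathbb K[x_1,\dots,x_n]$ be a $\mathbf d$-homogeneous ideal ($\mathbf d\in\mathbb Z^n_{>0}$), $C$ a maximal cone of its Gröbner fan, $<$ a compatible monomial term order and $\mathcal G$ the associated reduced Gröbner basis. Let $r_1,\dots,r_m\in C$ represent the primitive ray generators of $\overline C$, and suppose $r_1',\dots,r_m'\in C$ are such that $\overline{r}_i'=\overline r_i$ in $\mathbb R^n/\mathcal L(J)$. Let $\mathbf r$ and $\mathbf r'$ be the $(m\times n)$-matrices whose rows are $r_1,\dots,r_m$ and $r_1',\dots,r_m'$, respectively. Then for every $g\in\mathcal G$ we have $\tilde g_{\mathbf r}=\tilde g_{\mathbf r'}$.
   Context: $\mathbb K$ is an algebraically closed field. $J$ is $\mathbf d$-homogeneous if generated by homogeneous elements for $\deg x_i=d_i$. For $w\in\mathbb R^n$, $\operatorname{in}_w(f)$ is the sum of terms $c_\alpha\mathbf x^\alpha$ of $f$ with $w\cdot\alpha$ minimal, $\operatorname{in}_w(J)=\langle\operatorname{in}_w(f):f\in J\rangle$; for a monomial term order $<$, $\operatorname{in}_<(f)$ is the $<$-largest term. The Gröbner fan is the complete fan in $\mathbb R^n$ in which $u,w$ lie in the relative interior of the same cone iff $\operatorname{in}_u(J)=\operatorname{in}_w(J)$; maximal cones are $n$-dimensional; $<$ is compatible with $C$ if $\operatorname{in}_<(J)=\operatorname{in}_w(J)$ for $w\in C^\circ$. $\mathcal L(J)=\{u:\operatorname{in}_u(J)=J\}$ is the lineality space, $\overline C=C/\mathcal L(J)\subset\mathbb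 R^n/\mathcal L(J)$, $\overline r$ is the class of $r$. The representatives $r_i,r_i'$ are taken integral. For $0\neq f=\sum c_\alpha\mathbf x^\alpha\in J$ and a matrix $\mathbf r$ with rows $r_1,\dots,r_m$, $\mu_{\mathbf r}(f)=(\min_{c_\alpha\ne0}r_i\cdot\alpha)_{i}$ and $\tilde f_{\mathbf r}=\sum c_\alpha\mathbf x^\alpha\mathbf t^{\mathbf r\cdot\alpha-\mu_{\mathbf r}(f)}\in\mathbb K[t_1,\dots,t_m][x_1,\dots,x_n]$. *)

(* Defs.v *)
From HB Require Import structures.
From mathcomp Require Import all_boot all_order all_algebra.
From mathcomp Require Import generic_quotient ring_quotient.
From mathcomp Require Import boolp classical_sets functions cardinality reals.
From mathcomp Require Import topology.
From mathcomp Require Import mpoly.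

Set Implicit Arguments.
Unset Strict Implicit.
Unset Printing Implicit Defensive.

Import Order.TTheory GRing.Theory Num.Theory numFieldTopology.Exports.

Local Open Scope ring_scope.
Local Open Scope quotient_scope.
Local Open Scope classical_set_scope.

(* The ideal may be the whole ring, contrary to ring_quotient's idealr. *)
Record ideal (A : comNzRingType) := Ideal {
  ideal_set :> set A;
  ideal0 : ideal_set 0;
  idealD : forall f g, ideal_set f -> ideal_set g -> ideal_set (f + g);
  idealM : forall f g, ideal_set g -> ideal_set (f * g)
}.

Definition ideal_gen (A : comNzRingType) (S : set A) : set A :=
  [set f | forall I : ideal A, S `<=` I -> ideal_set I f].

Section Weights.
Variables (K : closedFieldType) (n : nat).
Implicit Types (f : {mpoly K[n]}) (J : ideal {mpoly K[n]}).

Definition wdeg (T : pzRingType) (w : 'rV[T]_n) (a : 'X_{1..n}) : T :=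
  \sum_(j < n) w 0 j *+ a j.

Definition weighted_homogeneous (d : 'rV[int]_n) f :=
  exists k : int, forall a, a \in msupp f -> wdeg d a = k.

Definition homogeneous_ideal (d : 'rV[int]_n) J :=
  exists2 S : set {mpoly K[n]},
    (forall f, S f -> weighted_homogeneous d f) & J = ideal_gen S :> set _.

Definition terms_sum (P : pred 'X_{1..n}) f : {mpoly K[n]} :=
  \sum_(a <- msupp f | P a) f@_a *: 'X_[a].

Definition init_form (R : realType) (w : 'rV[R]_n) f : {mpoly K[n]} :=
  terms_sum (fun a => all (fun b => wdeg w a <= wdeg w b) (msupp f)) f.

Definition init_ideal (R : realType) (w : 'rV[R]_n) J : set {mpoly K[n]} :=
  ideal_gen (init_form w @` J).

Definition term_order (lt : rel 'X_{1..n}) :=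
  [/\ irreflexive lt, transitive lt,
      forall a b, a != b -> lt a b || lt b a,
      forall a, a != 0%MM -> lt 0%MM a &
      forall a b c, lt a b -> lt (a + c)%MM (b + c)%MM].

Definition init_term (lt : rel 'X_{1..n}) f : {mpoly K[n]} :=
  terms_sum (fun a => all (fun b => (b == a) || lt b a) (msupp f)) f.

Definition init_ideal_order (lt : rel 'X_{1..n}) J : set {mpoly K[n]} :=
  ideal_gen (init_term lt @` J).

Definition reduced_groebner_basis (lt : rel 'X_{1..n}) J
    (G : seq {mpoly K[n]}) :=
  [/\ forall g, g \in G -> ideal_set J g,
      init_ideal_order lt J = ideal_gen (init_term lt @` [set` G]),
      forall g, g \in G -> exists a, init_term lt g = 'X_[a] &
      forall g a, g \in G -> a \in msupp g ->
        ~ ideal_gen (init_term lt @` ([set` G] `\ g)) 'X_[a]].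

End Weights.

Section Homogenization.
Variables (K : closedFieldType) (n m : nat) (r : 'M[int]_(m, n)).
Implicit Type f : {mpoly K[n]}.

(* Only meaningful for f != 0, in which case mlead f is in msupp f. *)
Definition min_weight f (i : 'I_m) : int :=
  \big[Order.min / wdeg (row i r) (mlead f)]_(a <- msupp f) wdeg (row i r) a.

(* The differences are nonnegative, so the absolute value is the identity. *)
Definition tilde_exponent f (a : 'X_{1..n}) : 'X_{1..m} :=
  [multinom `|wdeg (row i r) a - min_weight f i|%N | i < m].

Definition tilde f : {mpoly {mpoly K[m]}[n]} :=
  \sum_(a <- msupp f) (f@_a *: 'X_[tilde_exponent f a]) *: 'X_[a].

End Homogenization.

Record subspace (R : pzRingType) (V : lmodType R) := Subspace {
  subspace_pred :> {pred V};
  subspace_zmod_closed : zmod_closed subspace_pred;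
  subspace_scaler_closed : scaler_closed subspace_pred
}.

HB.instance Definition _ (R : pzRingType) (V : lmodType R) (U : subspace V) :=
  GRing.isZmodClosed.Build V (subspace_pred U) (subspace_zmod_closed U).
HB.instance Definition _ (R : pzRingType) (V : lmodType R) (U : subspace V) :=
  GRing.isScaleClosed.Build R V (subspace_pred U) (@subspace_scaler_closed R V U).

Section QuotientSpace.
Variables (R : pzRingType) (V : lmodType R) (U : subspace V).

Definition quotient_space := Quotient.quot (subspace_pred U).

HB.instance Definition _ := Choice.on quotient_space.
HB.instance Definition _ := Quotient.on quotient_space.
HB.instance Definition _ := GRing.Zmodule.on quotient_space.

Definition qclass (v : V) : quotient_space := \pi_quotient_space v.

Lemma qclassE u v : (qclass u == qclass v) = (u - v \in U).
Proof. by rewrite /qclass -Quotient.idealrBE. Qed.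

Lemma qclassK (q : quotient_space) : qclass (repr q) = q.
Proof. exact: reprK. Qed.

Lemma qclassD u v : qclass (u + v) = qclass u + qclass v.
Proof. exact: (@pi_addr _ _ _ _ _ (Quotient.quot (subspace_pred U))). Qed.

Definition quotient_scale (c : R) (q : quotient_space) := qclass (c *: repr q).

Lemma qclassZ c v : qclass (c *: v) = quotient_scale c (qclass v).
Proof.
by apply/eqP; rewrite qclassE -scalerBr rpredZ // -qclassE qclassK.
Qed.

Lemma quotient_scaleA a b q :
  quotient_scale a (quotient_scale b q) = quotient_scale (a * b) q.
Proof. by rewrite -(qclassK q) -!qclassZ scalerA. Qed.

Lemma quotient_scale1 : left_id 1 quotient_scale.
Proof. by move=> q; rewrite -(qclassK q) -qclassZ scale1r. Qed.

Lemma quotient_scaleDr : right_distributive quotient_scale +%R.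
Proof.
by move=> c p q; rewrite -(qclassK p) -(qclassK q) -qclassD -!qclassZ scalerDr qclassD.
Qed.

Lemma quotient_scaleDl q : {morph quotient_scale^~ q : a b / a + b}.
Proof. by move=> a b /=; rewrite -(qclassK q) -!qclassZ scalerDl qclassD. Qed.

HB.instance Definition _ := GRing.Zmodule_isLmodule.Build R quotient_space
  quotient_scaleA quotient_scale1 quotient_scaleDr quotient_scaleDl.

Lemma qclass_is_linear : linear qclass.
Proof. by move=> c u v; rewrite qclassD qclassZ. Qed.

HB.instance Definition _ :=
  GRing.isLinear.Build R V quotient_space *:%R qclass qclass_is_linear.

End QuotientSpace.

Section Lineality.
Variables (R : realType) (K : closedFieldType) (n : nat).
Variable J : ideal {mpoly K[n]}.
Implicit Types (f : {mpoly K[n]}) (u v w : 'rV[R]_n).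

Definition in_lineality : pred 'rV[R]_n :=
  fun u => `[< init_ideal u J = J :> set _ >].

Let homog_part (phi : 'X_{1..n} -> R) c : {mpoly K[n]} -> {mpoly K[n]} :=
  terms_sum (fun a => phi a == c).
Let graded (phi : 'X_{1..n} -> R) :=
  forall f c, ideal_set J f -> ideal_set J (homog_part phi c f).

Lemma mcoeff_terms_sum (P : pred 'X_{1..n}) f a :
  (terms_sum P f)@_a = if P a then f@_a else 0.
Proof.
rewrite /terms_sum linear_sum /= -big_filter.
case: (boolP (a \in [seq b <- msupp f | P b])) => [ain|anin].
  rewrite (bigD1_seq a) ?filter_uniq ?msupp_uniq //= big1_seq => [|b /andP[ba _]].
    rewrite addr0 mcoeffZ mcoeffX eqxx mulr1.
    by move: ain; rewrite mem_filter => /andP[-> _].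
  by rewrite mcoeffZ mcoeffX (negPf ba) mulr0.
rewrite big1_seq => [|b /andP[_ bin]].
  by move: anin; rewrite mem_filter; case: (P a) => //= /memN_msupp_eq0 ->.
rewrite mcoeffZ mcoeffX; case: eqP => [ba|_]; last by rewrite mulr0.
by rewrite -ba bin in anin.
Qed.

Lemma terms_sum_eq0 (P : pred 'X_{1..n}) f :
  {in msupp f, forall a, ~~ P a} -> terms_sum P f = 0.
Proof. by move=> fP; apply: big1_seq => a /andP[Pa /fP]; rewrite Pa. Qed.

Lemma terms_sum_id (P : pred 'X_{1..n}) f :
  {in msupp f, forall a, P a} -> terms_sum P f = f.
Proof.
move=> fP; apply/mpolyP => a; rewrite mcoeff_terms_sum; case: ifP => // NPa.
case: (boolP (a \in msupp f)) => [/fP|/memN_msupp_eq0 //]; by rewrite NPa.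
Qed.

Lemma idealN f : ideal_set J f -> ideal_set J (- f).
Proof. by rewrite -mulN1r; exact: idealM. Qed.

Lemma init_formP w f : f != 0 ->
  exists2 a, a \in msupp f & init_form w f = homog_part (wdeg w) (wdeg w a) f.
Proof.
move=> f0; have := mlead_supp f0; move: (mlead f) => a0 a0f.
pose g (i : 'I_(size (msupp f))) := wdeg w (nth 0%MM (msupp f) i).
have i0 : 'I_(size (msupp f)).
  by exists (index a0 (msupp f)); rewrite index_mem.
case: (@Order.TotalTheory.arg_minP _ _ _ i0 xpredT g erefl) => i _ imin.
have amin b : b \in msupp f -> g i <= wdeg w b.
  move=> bf; have bs : (index b (msupp f) < size (msupp f))%N by rewrite index_mem.
  by have := imin (Ordinal bs) erefl; rewrite /g /= nth_index.
exists (nth 0%MM (msupp f) i); first exact: mem_nth.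
apply/mpolyP => a; rewrite !mcoeff_terms_sum.
case: (boolP (a \in msupp f)) => [af|/memN_msupp_eq0 ->]; last by rewrite !if_same.
congr (if _ then _ else _); apply/allP/eqP => [amin'|ai b bf].
  by apply/eqP; rewrite eq_le amin' ?mem_nth // amin.
by rewrite ai; exact: amin.
Qed.

Lemma lineality_graded u : u \in in_lineality <-> graded (wdeg u).
Proof.
rewrite inE; split.
  move=> uJ f c; have [k] := ubnP (size (msupp f)); elim: k f => // k IHk f fk Jf.
  have [->|f0] := eqVneq f 0.
    by rewrite /homog_part terms_sum_eq0 ?msupp0 //; exact: ideal0.
  have [a af fE] := init_formP u f0.
  have Jg : ideal_set J (homog_part (wdeg u) (wdeg u a) f).
    rewrite -fE; rewrite -[X in X _](_ : init_ideal u J = J) //.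
    by move=> I; apply; exists f.
  set g := homog_part _ _ f in Jg.
  have [<-//|ca] := eqVneq (wdeg u a) c.
  have -> : homog_part (wdeg u) c f = homog_part (wdeg u) c (f - g).
    apply/mpolyP => b; rewrite !mcoeff_terms_sum; case: eqP => // bc.
    by rewrite mcoeffB mcoeff_terms_sum bc eq_sym (negPf ca) subr0.
  apply: IHk; last by apply: idealD => //; exact: idealN.
  rewrite -ltnS; apply: leq_trans fk; rewrite ltnS.
  have sub : {subset a :: msupp (f - g) <= msupp f}.
    move=> b; rewrite inE => /predU1P[->//|].
    rewrite !mcoeff_msupp mcoeffB mcoeff_terms_sum.
    by case: ifP => _; rewrite ?subrr ?eqxx ?subr0.
  apply: (uniq_leq_size _ sub) => /=; rewrite msupp_uniq andbT.
  by rewrite mcoeff_msupp mcoeffB mcoeff_terms_sum eqxx subrr eqxx.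
move=> gJ; apply/seteqP; split => f.
  apply => _ [h Jh <-]; have [->|h0] := eqVneq h 0.
    by rewrite /init_form terms_sum_eq0 ?msupp0 //; exact: ideal0.
  by have [a _ ->] := init_formP u h0; exact: gJ.
move=> Jf I JI.
suff -> : f = \sum_(c <- undup (map (wdeg u) (msupp f))) homog_part (wdeg u) c f.
  elim/big_ind: _ => [|x y|c _]; [exact: ideal0|exact: idealD|].
  apply: JI; exists (homog_part (wdeg u) c f); first exact: gJ.
  have hc b : b \in msupp (homog_part (wdeg u) c f) -> wdeg u b = c.
    rewrite mcoeff_msupp mcoeff_terms_sum.
    by case: (wdeg u b =P c) => // _; rewrite eqxx.
  by apply: terms_sum_id => a /hc ac; apply/allP => b /hc ->; rewrite ac.
apply/mpolyP => a; rewrite linear_sum /=.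
case: (boolP (a \in msupp f)) => [af|anf]; last first.
  rewrite (memN_msupp_eq0 anf) big1 // => c _.
  by rewrite mcoeff_terms_sum (memN_msupp_eq0 anf) if_same.
rewrite (bigD1_seq (wdeg u a)) ?undup_uniq ?mem_undup ?map_f //=.
rewrite mcoeff_terms_sum eqxx big1 ?addr0 // => c ca.
by rewrite mcoeff_terms_sum eq_sym (negPf ca).
Qed.

Lemma wdegZD (c : R) u v a : wdeg (c *: u + v) a = c * wdeg u a + wdeg v a.
Proof.
rewrite /wdeg mulr_sumr -big_split; apply: eq_bigr => j _ /=.
by rewrite !mxE mulrnDl mulrnAr.
Qed.

Lemma lineality_linear (c : R) u v :
  u \in in_lineality -> v \in in_lineality -> c *: u + v \in in_lineality.
Proof.
move=> /lineality_graded gu /lineality_graded gv; apply/lineality_graded => f e Jf.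
suff -> : homog_part (wdeg (c *: u + v)) e f =
    \sum_(k <- undup (map (wdeg u) (msupp f)))
      homog_part (wdeg v) (e - c * k) (homog_part (wdeg u) k f).
  elim/big_ind: _ => [|x y|k _]; [exact: ideal0|exact: idealD|].
  exact/gv/gu.
apply/mpolyP => a; rewrite [RHS]linear_sum /=.
case: (boolP (a \in msupp f)) => [af|anf]; last first.
  rewrite !mcoeff_terms_sum (memN_msupp_eq0 anf) if_same big1 // => k _.
  by rewrite !mcoeff_terms_sum (memN_msupp_eq0 anf) !if_same.
rewrite (bigD1_seq (wdeg u a)) ?undup_uniq ?mem_undup ?map_f //=.
rewrite !mcoeff_terms_sum eqxx wdegZD big1 ?addr0 => [|k ka].
  by rewrite [in RHS]eq_sym subr_eq addrC eq_sym.
by rewrite !mcoeff_terms_sum [wdeg u a == k]eq_sym (negPf ka) if_same.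
Qed.

Lemma lineality0 : 0 \in in_lineality.
Proof.
apply/lineality_graded => f c Jf.
have w0 a : wdeg (0 : 'rV[R]_n) a = 0.
  by rewrite /wdeg big1 // => j _; rewrite mxE mul0rn.
have [->|c0] := eqVneq c 0.
  by rewrite /homog_part terms_sum_id // => a _; rewrite w0.
rewrite /homog_part terms_sum_eq0 => [|a _]; first exact: ideal0.
by rewrite w0 eq_sym.
Qed.

Lemma lineality_zmod_closed : zmod_closed in_lineality.
Proof.
split=> [|u v Lu Lv]; first exact: lineality0.
by rewrite addrC -scaleN1r; exact: lineality_linear.
Qed.

Lemma lineality_scaler_closed : scaler_closed in_lineality.
Proof.
move=> c u Lu; rewrite -[c *: u]addr0.
by apply: lineality_linear => //; exact: lineality0.
Qed.

Definition lineality : subspace 'rV[R]_n :=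
  Subspace lineality_zmod_closed lineality_scaler_closed.

End Lineality.
Arguments lineality R {K n} J.

Section Cones.
Variables (R : realType) (V : lmodType R).
Implicit Types (C D : set V) (u v : V).

Definition polyhedral_cone C :=
  exists (k : nat) (l : 'I_k -> {linear V -> R^o}),
    C = [set v | forall i, 0 <= l i v].

Definition face C D :=
  exists2 l : {linear V -> R^o},
    forall v, C v -> 0 <= l v & D = [set v | C v /\ l v = 0].

Definition linear_span C : set V :=
  [set v | exists (k : nat) (c : 'I_k -> R) (s : 'I_k -> V),
     (forall i, C (s i)) /\ v = \sum_(i < k) c i *: s i].

Definition ray v : set V := [set c *: v | c in [set c : R | 0 <= c]].

Definition primitive_ray_generator (N : set V) C v :=
  [/\ v != 0, N v, face C (ray v) &
      forall u, N u -> ray v u -> exists k : nat, u = v *+ k].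

End Cones.

Section Fans.
Variables (R : realType) (n : nat).
Implicit Types (F : set (set 'rV[R]_n)) (C : set 'rV[R]_n).

(* The affine hull of a cone is its linear span. *)
Definition relint C : set 'rV[R]_n :=
  [set v | C v /\ within (linear_span C) (nbhs v) C].

Definition fan F :=
  [/\ finite_set F, F `<=` @polyhedral_cone R 'rV[R]_n,
      forall C D, F C -> face C D -> F D &
      forall C D, F C -> F D -> face C (C `&` D) /\ face D (C `&` D)].

Definition complete_fan F := fan F /\ \bigcup_(C in F) C = setT.

Definition maximal_cone F C := F C /\ forall D, F D -> C `<=` D -> D = C.

Variable K : closedFieldType.
Implicit Type J : ideal {mpoly K[n]}.

Definition groebner_fan J F :=
  complete_fan F /\
  forall u w, (exists C, [/\ F C, relint C u & relint C w]) <->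
              init_ideal u J = init_ideal w J.

Definition compatible J (lt : rel 'X_{1..n}) C :=
  forall w, relint C w -> init_ideal_order lt J = init_ideal w J.

End Fans.

Section RayMatrices.
Variables (R : realType) (K : closedFieldType) (n : nat).
Variable J : ideal {mpoly K[n]}.

Definition real_row (v : 'rV[int]_n) : 'rV[R]_n := map_mx intr v.

Definition row_class (m : nat) (r : 'M[int]_(m, n)) (i : 'I_m) :
    quotient_space (lineality R J) :=
  qclass (lineality R J) (real_row (row i r)).

Definition quotient_lattice : set (quotient_space (lineality R J)) :=
  range (fun v : 'rV[int]_n => qclass (lineality R J) (real_row v)).

Definition quotient_cone (C : set 'rV[R]_n) :
    set (quotient_space (lineality R J)) :=
  qclass (lineality R J) @` C.

(* One representative for each primitive ray generator of C / L(J). *)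
Definition represents_ray_generators (C : set 'rV[R]_n) (m : nat)
    (r : 'M[int]_(m, n)) :=
  (forall i, C (real_row (row i r))) /\
  set_bij setT (primitive_ray_generator quotient_lattice (quotient_cone C))
    (row_class r).

End RayMatrices.
Arguments real_row R {n} v.
Arguments row_class R {K n} J {m} r i.

(* Main.v *)
Require Import Defs.
From mathcomp Require Import all_boot all_order all_algebra.
From mathcomp Require Import boolp classical_sets functions cardinality reals.
From mathcomp Require Import topology.
From mathcomp Require Import mpoly.

(** Write [u] for the difference of the [i]-th rows of [r'] and [r].  Equality
    of classes says that [u] lies in the lineality space, that is, [J] is
    graded by the [u]-weight ([lineality_graded]).

    The point is that every element [g] of the reduced Groebner basis is then
    [u]-homogeneous.  Let [x^a] be its initial term and [h] its [u]-component
    of weight [u . a].  As [J] is graded, [g - h] lies in [J], and its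
    exponents are exponents of [g] other than [a].  Such a polynomial vanishes
    ([reduced_tail_eq0]): its initial exponent [b] is divisible by the initial
    exponent of some [g'] in [G]; if [g' = g] then [a] divides [b], whereas
    [b] is below [a] in the term order, and if [g' != g] then [g] is not
    reduced at [b].

    Hence on the support of [g] the [r'_i]-weight is the [r_i]-weight plus a
    constant.  The minimum shifts by the same constant, so the exponents
    of [t] do not change ([tilde_eq_shift]). *)

Local Open Scope ring_scope.
Local Open Scope classical_set_scope.

Import Order.TTheory GRing.Theory Num.Theory.

Set Implicit Arguments.
Unset Strict Implicit.
Unset Printing Implicit Defensive.

Section MonomialIdeal.
Variables (K : closedFieldType) (n : nat).
Implicit Types (f g : {mpoly K[n]}) (A : set 'X_{1..n}).

Definition monomial_ideal_set A : set {mpoly K[n]} :=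
  [set f | forall b, b \in msupp f -> exists2 a, A a & (a <= b)%MM].

Fact monomial_ideal0 A : monomial_ideal_set A 0.
Proof. by move=> b; rewrite msupp0. Qed.

Fact monomial_idealD A f g :
  monomial_ideal_set A f -> monomial_ideal_set A g ->
  monomial_ideal_set A (f + g).
Proof.
move=> Af Ag b /msuppD_le; rewrite mem_cat => /orP[]; [exact: Af|exact: Ag].
Qed.

Fact monomial_idealM A f g :
  monomial_ideal_set A g -> monomial_ideal_set A (f * g).
Proof.
move=> Ag b /msuppM_le /allpairsP[[c e] /= [_ /Ag[a Aa ae] ->]].
by exists a => //; apply: lepm_trans ae _; exact: lem_addl.
Qed.

Definition monomial_ideal A : ideal {mpoly K[n]} :=
  Ideal (monomial_ideal0 A) (@monomial_idealD A) (@monomial_idealM A).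

(** Divisibility by a generator is a condition on supports that defines an
    ideal, so it passes from generators to everything they generate. *)
Lemma ideal_gen_monomial (S : set {mpoly K[n]}) A f b :
  (forall s, S s -> exists2 a, A a & s = 'X_[a]) ->
  ideal_gen S f -> b \in msupp f -> exists2 a, A a & (a <= b)%MM.
Proof.
move=> SA /(_ (monomial_ideal A)) If; apply: If => s /SA[a Aa ->] c.
by rewrite msuppX inE => /eqP ->; exists a => //; exact: lepm_refl.
Qed.

Lemma ideal_gen_mul_monomial (S : set {mpoly K[n]}) a b :
  S 'X_[a] -> (a <= b)%MM -> ideal_gen S 'X_[b].
Proof.
move=> Sa ab I SI; rewrite -(submK ab) mpolyXD.
by apply: idealM; apply: SI.
Qed.

End MonomialIdeal.

Section TermOrder.
Variables (K : closedFieldType) (n : nat) (lt : rel 'X_{1..n}).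
Hypothesis ltT : term_order lt.
Implicit Types (f g h : {mpoly K[n]}) (a b : 'X_{1..n}).

Lemma term_order_max (s : seq 'X_{1..n}) : s != [::] ->
  exists2 a, a \in s & all (fun b => (b == a) || lt b a) s.
Proof.
case: ltT => _ lt_trans lt_total _ _.
elim: s => // x s IH _; have [->|s0] := eqVneq s [::].
  by exists x; rewrite ?mem_head //= eqxx.
have [a as_ /allP amax] := IH s0.
have [xa|xNa] := boolP ((x == a) || lt x a).
  exists a; first by rewrite inE as_ orbT.
  by rewrite /= xa; apply/allP.
have ax : lt a x.
  by move: xNa; rewrite negb_or => /andP[/lt_total/orP[->//|//]].
exists x; first exact: mem_head.
rewrite /= eqxx; apply/allP => b /amax/orP[/eqP->|ba]; first by rewrite ax orbT.
by rewrite (lt_trans _ _ _ ba ax) orbT.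
Qed.

Lemma mem_msupp_init_term f b : b \in msupp (init_term lt f) ->
  b \in msupp f /\ all (fun c => (c == b) || lt c b) (msupp f).
Proof.
rewrite !mcoeff_msupp mcoeff_terms_sum.
by case: ifP => // _; rewrite ?eqxx.
Qed.

Lemma init_term_neq0 f : f != 0 -> exists b, b \in msupp (init_term lt f).
Proof.
rewrite -msupp_eq0 => /term_order_max[b bf bmax]; exists b.
by rewrite mcoeff_msupp mcoeff_terms_sum bmax -mcoeff_msupp.
Qed.

Lemma term_order_dvd a b : (a <= b)%MM -> ~~ lt b a.
Proof.
case: ltT => lt_irr lt_trans _ lt_pos lt_add ab; apply/negP => ba.
have [b_a0|b_a0] := eqVneq (b - a)%MM 0%MM.
  by move: ba; rewrite -(submK ab) b_a0 add0m lt_irr.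
have := lt_add _ _ a (lt_pos _ b_a0); rewrite add0m submK // => ab'.
by have := lt_trans _ _ _ ba ab'; rewrite lt_irr.
Qed.

Variables (J : ideal {mpoly K[n]}) (G : seq {mpoly K[n]}).
Hypothesis GJ : reduced_groebner_basis lt J G.

(** The tail of a reduced Groebner basis element consists of standard
    monomials, and these are linearly independent modulo the ideal. *)
Lemma reduced_tail_eq0 g a h : g \in G -> init_term lt g = 'X_[a] ->
  ideal_set J h -> {subset msupp h <= msupp g} -> a \notin msupp h -> h = 0.
Proof.
case: GJ => _ initJ monicG redG gG ga Jh hg ah; apply/eqP/negP => /negP h0.
have [b bh] := init_term_neq0 h0.
have [/[dup] bsh /hg bg _] := mem_msupp_init_term bh.
have inith : ideal_gen (init_term lt @` [set` G]) (init_term lt h).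
  by rewrite -initJ => I; apply; exists h.
pose A := [set e | exists2 g', g' \in G & init_term lt g' = 'X_[e] :> {mpoly K[n]}].
have [s [g' g'G <-]|e [g' g'G g'e] eb] := ideal_gen_monomial (A := A) _ inith bh.
  by have [e g'e] := monicG g' g'G; exists e => //; exists g'.
have [g'g|/eqP g'g] := eqVneq g' g; last first.
  apply: (redG g b gG bg); apply: ideal_gen_mul_monomial eb.
  by exists g'.
have [_ /allP amax] : a \in msupp g /\ all (fun c => (c == a) || lt c a) (msupp g).
  by apply: mem_msupp_init_term; rewrite ga msuppX mem_head.
have ea : e = a.
  apply/eqP; have := mem_head e [::].
  by rewrite -(msuppX K) -g'e g'g ga msuppX inE.
case/orP: (amax _ bg) => [/eqP ba|]; first by rewrite -ba bsh in ah.
by apply/negP; apply: term_order_dvd; rewrite -ea.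
Qed.

Lemma reduced_graded_homogeneous (T : eqType) (phi : 'X_{1..n} -> T) g a :
  (forall f c, ideal_set J f ->
    ideal_set J (terms_sum (fun b => phi b == c) f)) ->
  g \in G -> init_term lt g = 'X_[a] ->
  {in msupp g, forall b, phi b = phi a}.
Proof.
move=> gradJ gG ga; have [JG _ _ _] := GJ; have Jg := JG g gG.
set h := terms_sum (fun b => phi b == phi a) g.
have coef b : (g - h)@_b = if phi b == phi a then 0 else g@_b.
  by rewrite mcoeffB mcoeff_terms_sum; case: ifP; rewrite ?subrr ?subr0.
have gh0 : g - h = 0.
  apply: reduced_tail_eq0 gG ga _ _ _.
  - by apply: idealD => //; apply: idealN; exact: gradJ.
  - by move=> b; rewrite !mcoeff_msupp coef; case: ifP; rewrite ?eqxx.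
  - by rewrite mcoeff_msupp coef eqxx eqxx.
move=> b; rewrite mcoeff_msupp; have := coef b; rewrite gh0 mcoeff0.
by case: (phi b =P phi a) => // _ <-; rewrite eqxx.
Qed.

End TermOrder.

(** A common shift of the weights cancels in the difference with the minimum. *)
Lemma tilde_eq_shift (K : closedFieldType) (n m : nat) (r r' : 'M[int]_(m, n))
    (f : {mpoly K[n]}) (c : 'I_m -> int) : f != 0 ->
  (forall i, {in msupp f, forall a,
     wdeg (row i r') a = wdeg (row i r) a + c i}) ->
  tilde r f = tilde r' f.
Proof.
move=> f0 rr'; apply: eq_big_seq => a af; congr (_ *: 'X_[_] *: _).
apply/mnmP => i; rewrite !mnmE.
suff -> : min_weight r' f i = min_weight r f i + c i.
  by rewrite rr' // opprD addrACA subrr addr0.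
rewrite /min_weight big_seq [in RHS]big_seq.
apply: (big_ind2 (fun x y => x = y + c i)) => [|x1 x2 y1 y2 -> ->|b bf].
- by rewrite rr' // mlead_supp.
- by rewrite addr_minl.
- exact: rr'.
Qed.

Lemma wdeg_real_row (R : realType) n (v : 'rV[int]_n) (a : 'X_{1..n}) :
  wdeg (real_row R v) a = (wdeg v a)%:~R.
Proof.
rewrite /wdeg rmorph_sum; apply: eq_bigr => j _ /=.
by rewrite mxE rmorphMn.
Qed.

Theorem proposition3p3 (R : realType) (K : closedFieldType) (n : nat)
    (d : 'rV[int]_n) (J : ideal {mpoly K[n]})
    (F : set (set 'rV[R]_n)) (C : set 'rV[R]_n)
    (lt : rel 'X_{1..n}) (G : seq {mpoly K[n]})
    (m : nat) (r r' : 'M[int]_(m, n)) :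
  (forall j, 0 < d ord0 j) ->
  homogeneous_ideal d J ->
  groebner_fan J F ->
  maximal_cone F C ->
  term_order lt ->
  compatible J lt C ->
  reduced_groebner_basis lt J G ->
  represents_ray_generators J C r ->
  (forall i, C (real_row R (row i r'))) ->
  (forall i, row_class R J r' i = row_class R J r i) ->
  forall g, g \in G -> tilde r g = tilde r' g.
Proof.
move=> _ _ _ _ ltT _ GJ _ _ rr' g gG.
have [_ _ monicG _] := GJ; have [a ga] := monicG g gG.
have g0 : g != 0.
  apply: contraTneq (mem_head a [::]) => g0.
  by rewrite -(msuppX K) -ga g0 /init_term terms_sum_eq0 msupp0.
pose u i := real_row R (row i r') - real_row R (row i r).
have u_lineality i : u i \in lineality R J.
  by rewrite /u -qclassE; apply/eqP; exact: rr'.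
have wdegu i b :
    wdeg (u i) b = (wdeg (row i r') b - wdeg (row i r) b)%:~R.
  rewrite /u addrC -scaleN1r wdegZD !wdeg_real_row.
  by rewrite mulN1r addrC -rmorphB.
pose c i := wdeg (row i r') a - wdeg (row i r) a.
apply: (tilde_eq_shift (c := c)) => // i b bg.
have /lineality_graded gradJ : u i \in in_lineality J := u_lineality i.
have := reduced_graded_homogeneous ltT GJ gradJ gG ga bg.
by rewrite !wdegu => /intr_inj; rewrite -/(c i) => <-; rewrite addrC subrK.
Qed.
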